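(* Let $K$ be a field and $R=K[x_{ij},y_k : 1\le i<j\le 4,\ 1\le k\le 4]$ a polynomial ring. Put $$g_{14}=x_{12}y_2+x_{13}y_3+x_{14}y_4,\quad g_{24}=-x_{12}y_1+x_{23}y_3+x_{24}y_4,$$ $$g_{34}=-x_{13}y_1-x_{23}y_2+x_{34}y_4,\quad g_{44}=-x_{14}y_1-x_{24}y_2-x_{34}y_3,$$ $$g_{13}=x_{12}y_2+x_{13}y_3,\quad g_{23}=-x_{12}y_1+x_{23}y_3,\quad g_{33}=-x_{13}y_1-x_{23}y_2,$$ and let $L_4=\langle g_{14},g_{24},g_{34},g_{44}\rangle$. Then a minimal free resolution of $R/L_4$ is $$0\longrightarrow R\stackrel{d_{44}}{\longrightarrow}R^{5}\stackrel{d_{34}}{\longrightarrow}R^{7}\stackrel{d_{24}}{\longrightarrow}R^{4}\stackrel{d_{14}}{\longrightarrow}R\stackrel{d_{04}}{\longrightarrow}R/L_4\longrightarrow 0,$$ where $d_{04}$ is the projection map, $d_{14}=\begin{pmatrix}g_{14}&g_{24}&g_{34}&g_{44}\end{pmatrix}$, $$d_{24}=\begin{pmatrix} g_{44}+x_{14}y_1 & x_{24}y_1 & x_{34}y_1 & -y_1 & g_{24} & 0 & -g_{34}\\ x_{14}y_2 & g_{44}+x_{24}y_2 & x_{34}y_2 & -y_2 & -g_{14} & g_{34} & 0\\ x_{14}y_3 & x_{24}y_3 & g_{44}+x_{34}y_3 & -y_3 & 0 & -g_{24} & g_{14}\\ -g_{13} & -g_{23} & -g_{33} & -y_4 & 0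 & 0 & 0 \end{pmatrix},$$ $$d_{34}=\begin{pmatrix} -x_{23} & -y_1 & y_4 & 0 & 0\\ x_{13} & -y_2 & 0 & y_4 & 0\\ -x_{12} & -y_3 & 0 & 0 & y_4\\ 0 & 0 & -g_{13} & -g_{23} & -g_{33}\\ -x_{34} & 0 & y_2 & -y_1 & 0\\ -x_{14} & 0 & 0 & y_3 & -y_2\\ -x_{24} & 0 & -y_3 & 0 & y_1 \end{pmatrix},\qquad d_{44}=\begin{pmatrix}0\\ y_4\\ y_1\\ y_2\\ y_3\end{pmatrix}.$$
   Context: The polynomials $g_{14},g_{24},g_{34},g_{44}$ are the entries of $X_4Y_4$, where $X_4$ is the generic skew-symmetric $4\times 4$ matrix with $(i,j)$ entry $x_{ij}$ for $i<j$, and $Y_4=(y_1,y_2,y_3,y_4)^T$; so $L_4=I_1(X_4Y_4)$ is the ideal generated by the entries of $X_4Y_4$. Matrices act on column vectors. Minimality is in the sense of graded free resolutions over the standard graded ring $R$ (a resolution whose differentials have all matrix entries in the homogeneous maximal ideal generated by the variables). *)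

(* Defs.v *)
From HB Require Import structures.
From mathcomp Require Import all_boot all_order all_algebra.
From mathcomp Require Import generic_quotient ring_quotient.
From mathcomp Require Import boolp.
From mathcomp Require Import mpoly.

Set Implicit Arguments.
Unset Strict Implicit.
Unset Printing Implicit Defensive.

Import GRing.Theory.

Local Open Scope ring_scope.
Local Open Scope quotient_scope.

Definition ideal_gen (R : comNzRingType) (m : nat) (g : 'rV[R]_m) : {pred R} :=
  fun p => `[< exists c : 'cV[R]_m, p = \sum_(j < m) c j 0 * g 0 j >].

Section IdealQuotient.

Variables (R : comNzRingType) (m : nat) (g : 'rV[R]_m).

Lemma ideal_genP (p : R) :
  reflect (exists c : 'cV[R]_m, p = \sum_(j < m) c j 0 * g 0 j)
          (p \in ideal_gen g).
Proof. exact: asboolP. Qed.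

Lemma ideal_genM (a p : R) : p \in ideal_gen g -> a * p \in ideal_gen g.
Proof.
move=> /ideal_genP[c ->]; apply/ideal_genP; exists (a *: c).
by rewrite mulr_sumr; apply: eq_bigr => j _; rewrite mxE mulrA.
Qed.

Fact ideal_gen_zmod_closed : zmod_closed (ideal_gen g).
Proof.
split=> [|p q /ideal_genP[c ->] /ideal_genP[e ->]]; apply/ideal_genP.
  by exists 0; rewrite big1 // => j _; rewrite mxE mul0r.
exists (c - e); rewrite -sumrB.
by apply: eq_bigr => j _; rewrite !mxE mulrBl.
Qed.

HB.instance Definition _ :=
  GRing.isZmodClosed.Build R (ideal_gen g) ideal_gen_zmod_closed.

(* Not {ideal_quot _}, whose ring structure requires the ideal to be proper:
   only the R-module structure of R / <g> is needed. *)
Definition quot_ideal : Type := Quotient.quot (ideal_gen g).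

HB.instance Definition _ := GRing.Zmodule.on quot_ideal.

Definition quot_proj (p : R) : quot_ideal := \pi_(Quotient.quot (ideal_gen g)) p.

Lemma quot_projP (p q : R) :
  reflect (quot_proj p = quot_proj q) (p - q \in ideal_gen g).
Proof. by rewrite Quotient.idealrBE; apply: eqP. Qed.

Lemma quot_proj_surj (u : quot_ideal) : exists p, u = quot_proj p.
Proof. by exists (repr u); rewrite /quot_proj reprK. Qed.

Lemma quot_projB : zmod_morphism quot_proj.
Proof. exact: pi_is_zmod_morphism. Qed.

HB.instance Definition _ :=
  GRing.isZmodMorphism.Build R quot_ideal quot_proj quot_projB.

Definition quot_scale (a : R) (u : quot_ideal) : quot_ideal :=
  quot_proj (a * repr (u : Quotient.quot (ideal_gen g))).

Lemma quot_scaleE (a p : R) : quot_scale a (quot_proj p) = quot_proj (a * p).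
Proof.
apply/quot_projP; rewrite -mulrBr; apply/ideal_genM/quot_projP.
by rewrite /quot_proj reprK.
Qed.

Fact quot_scaleA (a b : R) (u : quot_ideal) :
  quot_scale a (quot_scale b u) = quot_scale (a * b) u.
Proof. by have [p ->] := quot_proj_surj u; rewrite !quot_scaleE mulrA. Qed.

Fact quot_scale1 : left_id 1 quot_scale.
Proof. by move=> u; have [p ->] := quot_proj_surj u; rewrite quot_scaleE mul1r. Qed.

Fact quot_scaleDr : right_distributive quot_scale +%R.
Proof.
move=> a u v; have [p ->] := quot_proj_surj u; have [q ->] := quot_proj_surj v.
by rewrite -raddfD !quot_scaleE -raddfD mulrDr.
Qed.

Fact quot_scaleDl (u : quot_ideal) :
  {morph quot_scale^~ u : a b / a + b}.
Proof.
by move=> a b; have [p ->] := quot_proj_surj u; rewrite !quot_scaleE -raddfD mulrDl.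
Qed.

HB.instance Definition _ := GRing.Zmodule_isLmodule.Build R quot_ideal
  quot_scaleA quot_scale1 quot_scaleDr quot_scaleDl.

End IdealQuotient.

Definition exact_at (U V W : zmodType) (f : U -> V) (h : V -> W) : Prop :=
  forall v : V, h v = 0 <-> exists u : U, v = f u.

(* The complex ... -> R^(b 2) -> R^(b 1) -> R^(b 0) -> M -> 0, where
   d i : R^(b i.+1) -> R^(b i) acts on column vectors. A resolution of length n
   is one whose ranks b i vanish for i > n; exactness at R^(b n) is then the
   injectivity of d n.-1. *)
Definition free_resolution (R : comNzRingType) (M : lmodType R) (b : nat -> nat)
    (d : forall i, 'M[R]_(b i, b i.+1)) (eps : 'cV[R]_(b 0) -> M) : Prop :=
  [/\ linear eps,
      forall u : M, exists v, u = eps v,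
      exact_at (fun v : 'cV[R]_(b 1) => d 0%N *m v) eps
    & forall i, exact_at (fun v : 'cV[R]_(b i.+2) => d i.+1 *m v)
                         (fun v : 'cV[R]_(b i.+1) => d i *m v)].

Section Graded.

Variables (K : fieldType) (n : nat).
Local Notation R := {mpoly K[n]}.

(* The component of degree t of the graded free module whose j-th basis vector
   has degree a j, that is, of \bigoplus_j R(- a j). *)
Definition homog_vec (m : nat) (a : 'I_m -> nat) (t : nat) (v : 'cV[R]_m) : Prop :=
  forall j, if (a j <= t)%N then v j 0 \is (t - a j).-homog else v j 0 == 0.

(* gr t is the component of degree t of M; the basis vectors of the free modules
   can be assigned degrees for which all the maps are homogeneous of degree 0. *)
Definition graded_complex (M : lmodType R) (gr : nat -> M -> Prop) (b : nat -> nat)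
    (d : forall i, 'M[R]_(b i, b i.+1)) (eps : 'cV[R]_(b 0) -> M) : Prop :=
  exists a : forall i, 'I_(b i) -> nat,
    (forall t v, homog_vec (@a 0%N) t v -> gr t (eps v))
    /\ (forall i t v, homog_vec (@a i.+1) t v -> homog_vec (@a i) t (d i *m v)).

Definition max_ideal : {pred R} := ideal_gen (\row_(i < n) ('X_i : R)).

Definition minimal_graded_free_resolution (M : lmodType R) (gr : nat -> M -> Prop)
    (b : nat -> nat) (d : forall i, 'M[R]_(b i, b i.+1))
    (eps : 'cV[R]_(b 0) -> M) : Prop :=
  [/\ free_resolution d eps,
      graded_complex gr d eps
    & forall i j k, d i j k \in max_ideal].

(* The grading R / <g> inherits from R, meaningful for homogeneous g. *)
Definition quot_grading (m : nat) (g : 'rV[R]_m) (t : nat) (u : quot_ideal g) : Prop :=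
  exists2 p : R, p \is t.-homog & u = quot_proj g p.

End Graded.

Definition mx_of_rows (R : nzRingType) (m n : nat) (rows : seq (seq R)) : 'M[R]_(m, n) :=
  \matrix_(i, j) nth 0 (nth [::] rows i) j.

Section L4.

Variable K : fieldType.
Local Notation R := {mpoly K[10]}.

Definition x12 : R := 'X_(@Ordinal 10 0 isT).
Definition x13 : R := 'X_(@Ordinal 10 1 isT).
Definition x14 : R := 'X_(@Ordinal 10 2 isT).
Definition x23 : R := 'X_(@Ordinal 10 3 isT).
Definition x24 : R := 'X_(@Ordinal 10 4 isT).
Definition x34 : R := 'X_(@Ordinal 10 5 isT).
Definition y1 : R := 'X_(@Ordinal 10 6 isT).
Definition y2 : R := 'X_(@Ordinal 10 7 isT).
Definition y3 : R := 'X_(@Ordinal 10 8 isT).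
Definition y4 : R := 'X_(@Ordinal 10 9 isT).

Definition g14 : R := x12 * y2 + x13 * y3 + x14 * y4.
Definition g24 : R := - x12 * y1 + x23 * y3 + x24 * y4.
Definition g34 : R := - x13 * y1 - x23 * y2 + x34 * y4.
Definition g44 : R := - x14 * y1 - x24 * y2 - x34 * y3.
Definition g13 : R := x12 * y2 + x13 * y3.
Definition g23 : R := - x12 * y1 + x23 * y3.
Definition g33 : R := - x13 * y1 - x23 * y2.

Definition gens4 : 'rV[R]_4 := mx_of_rows 1 4 [:: [:: g14; g24; g34; g44]].

Definition R_mod_L4 : lmodType R := quot_ideal gens4.

Definition d04 (v : 'cV[R]_1) : R_mod_L4 := quot_proj gens4 (v 0 0).

Definition d14 : 'M[R]_(1, 4) := mx_of_rows 1 4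
  [:: [:: g14; g24; g34; g44]].

Definition d24 : 'M[R]_(4, 7) := mx_of_rows 4 7
  [:: [:: g44 + x14 * y1; x24 * y1; x34 * y1; - y1; g24; 0; - g34];
      [:: x14 * y2; g44 + x24 * y2; x34 * y2; - y2; - g14; g34; 0];
      [:: x14 * y3; x24 * y3; g44 + x34 * y3; - y3; 0; - g24; g14];
      [:: - g13; - g23; - g33; - y4; 0; 0; 0]].

Definition d34 : 'M[R]_(7, 5) := mx_of_rows 7 5
  [:: [:: - x23; - y1; y4; 0; 0];
      [:: x13; - y2; 0; y4; 0];
      [:: - x12; - y3; 0; 0; y4];
      [:: 0; 0; - g13; - g23; - g33];
      [:: - x34; 0; y2; - y1; 0];
      [:: - x14; 0; 0; y3; - y2];
      [:: - x24; 0; - y3; 0; y1]].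

Definition d44 : 'M[R]_(5, 1) := mx_of_rows 5 1
  [:: [:: 0]; [:: y4]; [:: y1]; [:: y2]; [:: y3]].

Definition ranks4 (i : nat) : nat := nth 0%N [:: 1; 4; 7; 5; 1]%N i.

Definition diff4 (i : nat) : 'M[R]_(ranks4 i, ranks4 i.+1) :=
  match i return 'M[R]_(ranks4 i, ranks4 i.+1) with
  | 0 => d14
  | 1 => d24
  | 2 => d34
  | 3 => d44
  | _ => 0
  end.

End L4.

(* Main.v *)
Require Import Defs.
From mathcomp Require Import all_boot all_order all_algebra.
From mathcomp Require Import mpoly.
From mathcomp Require Import ring.
Set Implicit Arguments.
Unset Strict Implicit.
Unset Printing Implicit Defensive.

Import GRing.Theory.
Local Open Scope ring_scope.

(* Setting y4 = 0 turns g14, g24, g34 into g13, g23, g33, the 2x2 minors (up to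
   sign) of the matrix with rows u = (x23, - x13, x12) and y = (y1, y2, y3).
   Exactness then rests on three facts:
   - the syzygies of g13, g23, g33 are generated by u and y (Hilbert-Burch);
   - g14, g24, g34 is a regular sequence;
   - g44 is a nonzerodivisor modulo (g13, g23, g33), so that
     (g14, g24, g34) : g44 = (g13, g23, g33, y4).
   Each regularity statement is reduced to one about a variable by the remark
   that a X + c, with a, c and the generators of I not involving X, is a
   nonzerodivisor modulo I as soon as a is. *)

(** * Polynomials in one distinguished variable *)

Section OneVariable.

Variables (A : idomainType) (n : nat) (i : 'I_n).
Local Notation R := {mpoly A[n]}.

(* Sealed by Qed: unfolding the underlying [mmap] makes unification diverge. *)
Fact poly_in_subproof : {f : {rmorphism R -> {poly R}} |
  (forall c, f c%:MP = (c%:MP)%:P)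
  /\ (forall j, f 'X_j = if j == i then 'X else ('X_j)%:P)}.
Proof.
exists (mmap (polyC \o (mpolyC n (R := A)))
             (fun j => if j == i then 'X else ('X_j : R)%:P)).
by split=> [c|j]; [exact: mmapC | rewrite /= mmapX mmap1U].
Qed.

(* [p] viewed as a polynomial in ['X_i]. *)
Definition poly_in : {rmorphism R -> {poly R}} := sval poly_in_subproof.

Lemma poly_inC c : poly_in c%:MP = (c%:MP)%:P.
Proof. exact: (svalP poly_in_subproof).1. Qed.

Lemma poly_inX j : poly_in 'X_j = if j == i then 'X else ('X_j)%:P.
Proof. exact: (svalP poly_in_subproof).2. Qed.

Lemma horner_poly_in p : (poly_in p).['X_i] = p.
Proof.
elim/mpolyind: p => [|c m p _ _ IHp]; first by rewrite rmorph0 horner0.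
rewrite rmorphD hornerD IHp.
rewrite -[c *: _]mul_mpolyC.
rewrite (rmorphM poly_in).
rewrite hornerM; congr (_ * _ + _).
  by rewrite poly_inC hornerC.
rewrite {1}mpolyXE_id rmorph_prod horner_prod [RHS]mpolyXE_id.
apply: eq_bigr => j _; rewrite rmorphXn /= poly_inX horner_exp.
by case: eqP => [->|_]; rewrite ?hornerX ?hornerC.
Qed.

Fact kill_subproof : {f : {rmorphism R -> R} | forall p, f p = (poly_in p).[0]}.
Proof. by exists (horner_eval 0 \o poly_in). Qed.

(* The substitution ['X_i := 0]. *)
Definition kill : {rmorphism R -> R} := sval kill_subproof.

Lemma killE p : kill p = (poly_in p).[0].
Proof. exact: (svalP kill_subproof) p. Qed.

Lemma killX j : kill 'X_j = if j == i then 0 else 'X_j.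
Proof.
by rewrite killE poly_inX; case: ifP => _; rewrite ?hornerX ?hornerC.
Qed.

(** The factor theorem at 0 for [poly_in p], after which ['X_i] is substituted back. It lifts
    relations modulo ['X_i] to the full ring. *)
Lemma kill_decomp p : exists q, p = kill p + 'X_i * q.
Proof.
have /factor_theorem[q Dq] : root (poly_in p - (kill p)%:P) 0.
  by rewrite rootE hornerD hornerN hornerC killE subrr.
exists (q.['X_i]); rewrite -{1}(horner_poly_in p).
have /(congr1 (fun h => h.['X_i])) := Dq.
rewrite hornerD hornerN hornerC hornerM hornerD hornerN hornerX hornerC subr0.
by rewrite mulrC => /(canRL (subrK _)) ->; rewrite addrC.
Qed.

Lemma kill_eq0 p : kill p = 0 -> exists q, p = 'X_i * q.
Proof. by case: (kill_decomp p) => q Dq p0; exists q; rewrite Dq p0 add0r. Qed.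

Lemma mpolyX_neq0 : ('X_i : R) != 0.
Proof. by rewrite -msupp_eq0 msuppX. Qed.

(** ['X_i] is prime, being a generator of the kernel of [kill], whose values lie in a domain;
    [kill a != 0] says that ['X_i] does not divide [a]. *)
Lemma variable_prime a p q : kill a != 0 -> a * p = 'X_i * q ->
  exists r, p = 'X_i * r.
Proof.
move=> a0 /(congr1 kill); rewrite !rmorphM killX eqxx mul0r => /eqP.
by rewrite mulf_eq0 (negPf a0) => /eqP /kill_eq0.
Qed.

(** This expresses that ['X_i] does not occur in [p], in a form that rewrites directly inside
    coefficient computations. *)
Definition free_of p := poly_in p = p%:P.

(** Expand in powers of ['X_i]: the generators have degree 0, so all coefficients of [f * p] lie in
    the ideal. Going down from the top degree, so do those of [p], hence [p] itself. *)
Lemma nzd_mod_linear (m : nat) (g : 'rV[R]_m) (a c f p : R) :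
    (forall j, free_of (g 0 j)) -> free_of a -> free_of c ->
    f = a * 'X_i + c ->
    (forall q, a * q \in ideal_gen g -> q \in ideal_gen g) ->
  f * p \in ideal_gen g -> p \in ideal_gen g.
Proof.
move=> free_g free_a free_c -> nzd_a /ideal_genP[e De].
set I := ideal_gen g; pose h := poly_in p.
(* This is the coefficient of degree [k.+1] in [f * p]. *)
have coef_h k : a * h`_k + c * h`_k.+1 \in I.
  have /(congr1 (fun q => (poly_in q)`_k.+1)) := De.
  rewrite rmorphM rmorphD rmorphM free_a free_c poly_inX eqxx.
  rewrite mulrDl -mulrA coefD !coefCM coefXM /= => ->.
  rewrite rmorph_sum coef_sum; apply: rpred_sum => j _.
  rewrite rmorphM free_g coefMC; apply: ideal_genM.
  apply/ideal_genP; exists (delta_mx j 0); rewrite (bigD1 j) //= mxE !eqxx mul1r.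
  by rewrite big1 ?addr0 // => l /negPf lj; rewrite mxE lj mul0r.
(* Descending induction on [k], through the distance [d] to the size of [h], beyond which the
   coefficients are 0. *)
have h_in k d : (size h <= k + d)%N -> h`_k \in I.
  elim: d k => [|d IHd] k.
    by rewrite addn0 => /(nth_default 0) ->; apply: rpred0.
  rewrite addnS -addSn => /IHd hk1; apply: nzd_a.
  by rewrite -[_ * _](addrK (c * h`_k.+1)) rpredB ?coef_h ?ideal_genM.
rewrite -(horner_poly_in p) horner_coef; apply: rpred_sum => k _.
by rewrite mulrC ideal_genM // (h_in _ (size h)) ?leq_addl.
Qed.

Lemma free_ofX j : j != i -> free_of 'X_j.
Proof. by rewrite /free_of poly_inX => /negPf->. Qed.

Lemma free_ofD p q : free_of p -> free_of q -> free_of (p + q).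
Proof. by rewrite /free_of rmorphD polyCD => -> ->. Qed.

Lemma free_ofM p q : free_of p -> free_of q -> free_of (p * q).
Proof. by rewrite /free_of rmorphM polyCM => -> ->. Qed.

Lemma free_ofN p : free_of p -> free_of (- p).
Proof. by rewrite /free_of rmorphN polyCN => ->. Qed.

Lemma free_of0 : free_of 0.
Proof. by rewrite /free_of rmorph0. Qed.

Lemma free_of1 : free_of 1.
Proof. by rewrite /free_of rmorph1. Qed.

End OneVariable.

Arguments poly_in {A n} i.
Arguments kill {A n} i.
Arguments free_of {A n} i p.

(** * Ideals with at most three generators *)

Definition ideal1 (R : comNzRingType) (a : R) : {pred R} :=
  ideal_gen (mx_of_rows 1 1 [:: [:: a]]).
Definition ideal2 (R : comNzRingType) (a b : R) : {pred R} :=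
  ideal_gen (mx_of_rows 1 2 [:: [:: a; b]]).
Definition ideal3 (R : comNzRingType) (a b c : R) : {pred R} :=
  ideal_gen (mx_of_rows 1 3 [:: [:: a; b; c]]).

Section SmallIdeals.

Variables (R : comNzRingType) (a b c p : R).

Lemma ideal1P : reflect (exists u, p = u * a) (p \in ideal1 a).
Proof.
apply: (iffP (ideal_genP _ _)) => [[v ->]|[u ->]].
  by exists (v 0 0); rewrite big_ord1 mxE.
by exists (\col_i u); rewrite big_ord1 !mxE.
Qed.

Lemma ideal2P : reflect (exists u v, p = u * a + v * b) (p \in ideal2 a b).
Proof.
apply: (iffP (ideal_genP _ _)) => [[w ->]|[u [v ->]]].
  exists (w ord0 0), (w (lift ord0 ord0) 0).
  by rewrite !big_ord_recl big_ord0 addr0 !mxE.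
exists (\col_i nth 0 [:: u; v] i).
by rewrite !big_ord_recl big_ord0 addr0 !mxE.
Qed.

Lemma ideal3P :
  reflect (exists u v w, p = u * a + v * b + w * c) (p \in ideal3 a b c).
Proof.
apply: (iffP (ideal_genP _ _)) => [[t ->]|[u [v [w ->]]]].
  exists (t ord0 0), (t (lift ord0 ord0) 0), (t (lift ord0 (lift ord0 ord0)) 0).
  by rewrite !big_ord_recl big_ord0 addr0 !mxE addrA.
exists (\col_i nth 0 [:: u; v; w] i).
by rewrite !big_ord_recl big_ord0 addr0 !mxE addrA.
Qed.

End SmallIdeals.

(** The basis of the tactic [lc]: a goal follows from a hypothesis when both have the same
    difference of sides, which [ring] checks. The sign counts, whence the [esym] in some calls. *)
Lemma eq_of_sub (V : zmodType) (a b c d : V) : c = d -> a - b = c - d -> a = b.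
Proof. by move=> -> ab; apply: subr0_eq; rewrite ab subrr. Qed.

Lemma lin_comb2 (R : pzRingType) (k l a b c d : R) :
  a = b -> c = d -> k * a + l * c = k * b + l * d.
Proof. by move=> -> ->. Qed.

Ltac free := rewrite /g13 /g23 /g33 /g14 /g24 /g34 /g44;
  repeat first [exact: free_of1 | exact: free_of0 | apply: free_ofX; exact: isT
               | apply: free_ofD | apply: free_ofM | apply: free_ofN].

Ltac free_row := let j := fresh in
  move=> j; rewrite mxE; case: j => [[|[|[|//]]] ?] //=; free.

Ltac lc H := apply: (eq_of_sub H);
  rewrite /g14 /g24 /g34 /g44 /g13 /g23 /g33; ring.

(** * Matrix products in coordinates *)

Section Columns.

Variable R : comNzRingType.

(** Indexing by natural numbers lets the sums unroll into [f 0], [f 1], and so on, without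
    ordinals. *)
Lemma col_of_nat_fun (n : nat) (v : 'cV[R]_n) :
  exists f : nat -> R, v = \col_(i < n) f i.
Proof.
exists (fun k => oapp (fun i : 'I_n => v i 0) 0 (insub k)).
by apply/matrixP => i j; rewrite !mxE ord1 valK.
Qed.

Lemma mul_rows_col (m n : nat) (rows : seq (seq R)) (f : nat -> R) i :
  (mx_of_rows m n rows *m (\col_(j < n) f j)) i 0
    = \sum_(0 <= j < n) nth 0 (nth [::] rows i) j * f j.
Proof.
by rewrite mxE big_mkord; apply: eq_bigr => k _; rewrite !mxE.
Qed.

Lemma mul_rows_col_eq0 (m n : nat) (rows : seq (seq R)) (f : nat -> R) :
    mx_of_rows m n rows *m (\col_(j < n) f j) = 0 ->
  forall i, (i < m)%N -> \sum_(0 <= j < n) nth 0 (nth [::] rows i) j * f j = 0.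
Proof.
move=> /matrixP E i lt_i.
by have := E (Ordinal lt_i) 0; rewrite mul_rows_col mxE.
Qed.

Lemma col_eq_mul_rows (m n : nat) (rows : seq (seq R)) (f h : nat -> R) :
    (forall i, (i < m)%N ->
      h i = \sum_(0 <= j < n) nth 0 (nth [::] rows i) j * f j) ->
  \col_(i < m) h i = mx_of_rows m n rows *m (\col_(j < n) f j).
Proof. by move=> E; apply/matrixP => i j; rewrite ord1 mul_rows_col mxE E. Qed.

Lemma exact_at_mulmx m n p (A : 'M[R]_(m, n)) (B : 'M[R]_(n, p)) :
  A *m B = 0 -> (forall v : 'cV_n, A *m v = 0 -> exists u, v = B *m u) ->
  exact_at (fun u : 'cV[R]_p => B *m u) (fun v : 'cV[R]_n => A *m v).
Proof.
move=> AB0 sur v; split; first exact: sur.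
by case=> u ->; rewrite mulmxA AB0 mul0mx.
Qed.

Lemma mul_rows_eq0 m n p rows1 rows2 :
  (forall i k, (i < m)%N -> (k < p)%N ->
    \sum_(0 <= j < n) nth 0 (nth [::] rows1 i) j * nth 0 (nth [::] rows2 j) k
      = 0 :> R) ->
  mx_of_rows m n rows1 *m mx_of_rows n p rows2 = 0.
Proof.
move=> E; apply/matrixP => i k; rewrite !mxE -[RHS](E i k) // big_mkord.
by apply: eq_bigr => j _; rewrite !mxE.
Qed.

End Columns.

(** * Homogeneous matrices and the maximal ideal *)

Section Homogeneous.

Variables (K : fieldType) (l : nat).
Local Notation R := {mpoly K[l]}.

Lemma variable_homog i : ('X_i : R) \is 1.-homog.
Proof. by rewrite dhomogX /= mdeg1. Qed.

Lemma homog_mulmx m n (a : 'I_m -> nat) (b : 'I_n -> nat) (M : 'M[R]_(m, n)) t v :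
    (forall j k, (a j <= b k)%N && (M j k \is (b k - a j).-homog)) ->
  homog_vec b t v -> homog_vec a t (M *m v).
Proof.
move=> homM homv j; rewrite mxE.
have v0 k : (b k <= t)%N = false -> v k 0 = 0.
  by move=> bt; have := homv k; rewrite bt => /eqP.
case: ifP => at_; last first.
  (* If [t < a j], then [t < b k] for every [k], so all entries of [v] vanish. *)
  apply/eqP; apply: big1 => k _; rewrite v0 ?mulr0 //.
  by apply: contraFF at_; apply: leq_trans; case/andP: (homM j k).
apply: rpred_sum => k _; case bt: (b k <= t)%N; last by rewrite v0 // mulr0 rpred0.
have /andP[ab homMjk] := homM j k; have := homv k; rewrite bt => homvk.
(* Degrees add up: [(t - b k) + (b k - a j) = t - a j]. *)
by rewrite -(subnK bt) addnC -addnBAC // dhomogM.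
Qed.

Lemma variable_max_ideal i : 'X_i \in @max_ideal K l.
Proof.
apply/ideal_genP; exists (delta_mx i 0); rewrite (bigD1 i) //= big1 => [|j /negPf ji].
  by rewrite !mxE !eqxx mul1r addr0.
by rewrite !mxE ji mul0r.
Qed.

End Homogeneous.

Section L4.
Variable K : fieldType.
Local Notation R := {mpoly K[10]}.
Local Notation x12 := (x12 K). Local Notation x13 := (x13 K).
Local Notation x14 := (x14 K). Local Notation x23 := (x23 K).
Local Notation x24 := (x24 K). Local Notation x34 := (x34 K).
Local Notation y1 := (y1 K). Local Notation y2 := (y2 K).
Local Notation y3 := (y3 K). Local Notation y4 := (y4 K).
Local Notation g14 := (g14 K). Local Notation g24 := (g24 K).
Local Notation g34 := (g34 K). Local Notation g44 := (g44 K).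
Local Notation g13 := (g13 K). Local Notation g23 := (g23 K).
Local Notation g33 := (g33 K).

Local Notation o12 := (@Ordinal 10 0 isT).
Local Notation o13 := (@Ordinal 10 1 isT).
Local Notation o14 := (@Ordinal 10 2 isT).
Local Notation o23 := (@Ordinal 10 3 isT).
Local Notation o24 := (@Ordinal 10 4 isT).
Local Notation o34 := (@Ordinal 10 5 isT).
Local Notation o1 := (@Ordinal 10 6 isT).
Local Notation o2 := (@Ordinal 10 7 isT).
Local Notation o3 := (@Ordinal 10 8 isT).
Local Notation o4 := (@Ordinal 10 9 isT).

(** * The quadrics after setting one variable to 0 *)

Ltac kills := rewrite /g13 /g23 /g33 /g14 /g24 /g34 /g44
  ?(rmorphD, rmorphN, rmorphM) /=
  /Defs.x12 /Defs.x13 /Defs.x14 /Defs.x23 /Defs.x24 /Defs.x34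
  /Defs.y1 /Defs.y2 /Defs.y3 /Defs.y4 !killX /=
 ?(mulr0, mul0r, oppr0, addr0, add0r).

Lemma kill4_g14 : kill o4 g14 = g13.
Proof. by kills. Qed.

Lemma kill4_g24 : kill o4 g24 = g23.
Proof. by kills. Qed.

Lemma kill4_g33 : kill o4 g33 = g33.
Proof. by kills. Qed.

(** At [y3 = 0] only the monomial [x12 * y2] survives; thus [y3] does not divide [g13]. *)
Lemma kill3_g13_neq0 : kill o3 g13 != 0.
Proof. by kills; rewrite mulf_neq0 ?mpolyX_neq0. Qed.

Lemma g13_neq0 : g13 != 0.
Proof. by apply: contraNneq kill3_g13_neq0 => ->; rewrite rmorph0. Qed.

Lemma g23_neq0 : g23 != 0.
Proof.
suff: kill o3 g23 != 0 by apply: contraNneq => ->; rewrite rmorph0.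
by kills; rewrite mulf_neq0 ?oppr_eq0 ?mpolyX_neq0.
Qed.

Lemma g33_neq0 : g33 != 0.
Proof.
suff: kill o1 g33 != 0 by apply: contraNneq => ->; rewrite rmorph0.
by kills; rewrite oppr_eq0 mulf_neq0 ?mpolyX_neq0.
Qed.

(** * Regularity statements and the Hilbert-Burch syzygies *)

Ltac fold_vars := rewrite -/x12 -/x13 -/x14 -/x23 -/x24 -/x34 -/y1 -/y2 -/y3 -/y4.

(** [g23] is linear in [x23] with coefficient [y3], and [y3] is a nonzerodivisor modulo [g13]
    because it is a prime not dividing [g13]. *)
Lemma g23_nzd_mod_g13 p : g23 * p \in ideal1 g13 -> p \in ideal1 g13.
Proof.
apply: (@nzd_mod_linear K 10 o23 1 _ y3 (- x12 * y1)).
- free_row.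
- free.
- free.
- by fold_vars; rewrite /g23; ring.
move=> q /ideal1P[a Da]; have [b Db]: exists b, a = y3 * b.
  by apply: (variable_prime kill3_g13_neq0); rewrite mulrC -Da.
apply/ideal1P; exists b; apply: (mulfI (mpolyX_neq0 K o3)).
by rewrite mulrA -/y3 -Db.
Qed.

Lemma g24_nzd_mod_g14 p : g24 * p \in ideal1 g14 -> p \in ideal1 g14.
Proof.
apply: (@nzd_mod_linear K 10 o24 1 _ y4 (- x12 * y1 + x23 * y3)).
- free_row.
- free.
- free.
- by fold_vars; rewrite /g24; ring.
move=> q /ideal1P[a Da]; have [b Db]: exists b, a = y4 * b.
  apply: (@variable_prime K 10 o4 g14); last by rewrite mulrC -Da.
  by rewrite kill4_g14 g13_neq0.
apply/ideal1P; exists b; apply: (mulfI (mpolyX_neq0 K o4)).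
by rewrite mulrA -/y4 -Db.
Qed.

(** At [y4 = 0] the relation becomes a syzygy of the regular sequence [g13], [g23], hence a multiple
    of the Koszul one. Lifting it back leaves a multiple of [y4] to cancel. *)
Lemma y4_nzd_mod_g14_g24 q : y4 * q \in ideal2 g14 g24 -> q \in ideal2 g14 g24.
Proof.
move=> /ideal2P[a [b Dab]].
have := congr1 (kill o4) Dab.
rewrite rmorphM killX eqxx mul0r rmorphD !rmorphM kill4_g14 kill4_g24 => E0.
have [a' Da'] := kill_decomp o4 a; have [b' Db'] := kill_decomp o4 b.
move: (kill o4 a) (kill o4 b) E0 Da' Db' => a0 b0 E0 Da' Db'.
have /ideal1P[c Dc] : b0 \in ideal1 g13.
  by apply: g23_nzd_mod_g13; apply/ideal1P; exists (- a0); lc (esym E0).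
have Da : a0 = - c * g23.
  by apply: (mulfI g13_neq0); rewrite Dc in E0; lc (esym E0).
(* From [g13 * g14.2 - g23 * g14.1]-type cancellation: [g13 * g24 - g23 * g14 = y4 * (x24 * g14 -
   x14 * g24)]. *)
apply/ideal2P; exists (c * x24 + a'), (b' - c * x14).
apply: (mulfI (mpolyX_neq0 K o4)); rewrite -/y4.
have Da1 : a = a0 + y4 * a' by []. have Db1 : b = b0 + y4 * b' by [].
rewrite Dab Da1 Db1 Da Dc /g14 /g24 /g13 /g23; ring.
Qed.

(** [g34] is linear in [x34] with coefficient [y4]. This completes the regularity of [g14], [g24],
    [g34]. *)
Lemma g34_nzd_mod_g14_g24 p : g34 * p \in ideal2 g14 g24 -> p \in ideal2 g14 g24.
Proof.
apply: (@nzd_mod_linear K 10 o34 2 _ y4 (- x13 * y1 - x23 * y2)).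
- free_row.
- free.
- free.
- by fold_vars; rewrite /g34; ring.
exact: y4_nzd_mod_g14_g24.
Qed.

Lemma g34_nzd_mod_g24 p : g34 * p \in ideal1 g24 -> p \in ideal1 g24.
Proof.
apply: (@nzd_mod_linear K 10 o34 1 _ y4 (- x13 * y1 - x23 * y2)).
- free_row.
- free.
- free.
- by fold_vars; rewrite /g34; ring.
move=> q /ideal1P[a Da]; have [b Db]: exists b, a = y4 * b.
  apply: (@variable_prime K 10 o4 g24); last by rewrite mulrC -Da.
  by rewrite kill4_g24 g23_neq0.
apply/ideal1P; exists b; apply: (mulfI (mpolyX_neq0 K o4)).
by rewrite mulrA -/y4 -Db.
Qed.

Lemma y1_nzd_mod_x12_y3 q : y1 * q \in ideal2 x12 y3 -> q \in ideal2 x12 y3.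
Proof.
(* The degenerate linear form [1 * y1 + 0]: the generators do not involve [y1]. *)
apply: (@nzd_mod_linear K 10 o1 2 _ 1 0).
- free_row.
- free.
- free.
- by fold_vars; ring.
by move=> r; rewrite mul1r.
Qed.

Lemma g33_nzd_mod_x12_y3 p : g33 * p \in ideal2 x12 y3 -> p \in ideal2 x12 y3.
Proof.
apply: (@nzd_mod_linear K 10 o13 2 _ (- y1) (- x23 * y2)).
- free_row.
- free.
- free.
- by fold_vars; rewrite /g33; ring.
move=> q; rewrite mulNr => /ideal2P[a [b Dab]]; apply: y1_nzd_mod_x12_y3.
by apply/ideal2P; exists (- a), (- b); lc (congr1 -%R Dab).
Qed.

(** Both [g13] and [g23] lie in [(x12, y3)], modulo which [g33] is a nonzerodivisor, so [v3] lies
    there too. Subtracting a combination of the two known syzygies makes the third coordinate 0 and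
    leaves a Koszul syzygy of [g13], [g23]. *)
Lemma hilbert_burch v1 v2 v3 :
  v1 * g13 + v2 * g23 + v3 * g33 = 0 ->
  exists a b, [/\ v1 = a * x23 + b * y1, v2 = - a * x13 + b * y2
                & v3 = a * x12 + b * y3].
Proof.
move=> E.
have /ideal2P[a [b D3]] : v3 \in ideal2 x12 y3.
  apply: g33_nzd_mod_x12_y3; apply/ideal2P.
  by exists (- v1 * y2 + v2 * y1), (- v1 * x13 - v2 * x23); lc E.
have E2 : (v2 + a * x13 - b * y2) * g23 = - (v1 - a * x23 - b * y1) * g13.
  by rewrite D3 in E; lc E.
have /ideal1P[c D2] : v2 + a * x13 - b * y2 \in ideal1 g13.
  apply: g23_nzd_mod_g13; apply/ideal1P.
  by exists (- (v1 - a * x23 - b * y1)); rewrite mulrC.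
have D1 : v1 - a * x23 - b * y1 = - c * g23.
  by apply: (mulfI g13_neq0); rewrite D2 in E2; lc E2.
(* With [u = (x23, - x13, x12)] and [y = (y1, y2, y3)], the Koszul syzygy [(- g23, g13, 0)] is
   [x12 * y - y3 * u]. *)
exists (a - c * y3), (b + c * x12); split.
- by lc D1.
- by lc D2.
- by lc D3.
Qed.

(** At [y3 = 0] the relation reads [x12 * (a0 * y2 - b0 * y1) + c0 * g33 = 0]. Primality of [x12],
    then of [y1], solves it: [(a0, b0, c0)] is [e * (x23, - x13, x12) + k * (y1, y2, 0)]. *)
Lemma y3_nzd_mod_minors q : y3 * q \in ideal3 g13 g23 g33 -> q \in ideal3 g13 g23 g33.
Proof.
move=> /ideal3P[a [b [c D]]].
have E0 : 0 = kill o3 a * (x12 * y2) - kill o3 b * (x12 * y1) + kill o3 c * g33.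
  have := congr1 (kill o3) D; rewrite rmorphM killX eqxx mul0r => ->.
  rewrite !rmorphD !rmorphM.
  have -> : kill o3 g13 = x12 * y2 by kills.
  have -> : kill o3 g23 = - x12 * y1 by kills; rewrite mulNr.
  have -> : kill o3 g33 = g33 by kills.
  by rewrite mulNr mulrN.
have [a' Da'] := kill_decomp o3 a; have [b' Db'] := kill_decomp o3 b.
have [c' Dc'] := kill_decomp o3 c.
move: (kill o3 a) (kill o3 b) (kill o3 c) E0 Da' Db' Dc'
  => a0 b0 c0 E0 Da' Db' Dc'.
have [e De] : exists e, c0 = x12 * e.
  apply: (@variable_prime K 10 o12 g33 c0 (b0 * y1 - a0 * y2)).
    suff -> : kill o12 g33 = g33 by apply: g33_neq0.
    by kills.
  by fold_vars; lc (esym E0).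
have E1 : y2 * (a0 - e * x23) = y1 * (b0 + e * x13).
  apply: (mulfI (mpolyX_neq0 K o12)); fold_vars.
  by rewrite De in E0; lc (esym E0).
have [k Dk] : exists k, a0 - e * x23 = y1 * k.
  apply: (variable_prime _ E1).
  suff -> : kill o1 y2 = y2 by apply: mpolyX_neq0.
  by kills.
have Db : b0 + e * x13 = y2 * k.
  by apply: (mulfI (mpolyX_neq0 K o1)); fold_vars; rewrite Dk in E1; lc (esym E1).
(* The vectors [(x23, - x13, x12)] and [(y1, y2, y3)] are syzygies, so [(a0, b0, c0)] contributes
   only [- k * y3 * g33]. *)
apply/ideal3P; exists a', b', (c' - k).
apply: (mulfI (mpolyX_neq0 K o3)); fold_vars.
have Da1 : a = a0 + y3 * a' by []. have Db1 : b = b0 + y3 * b' by [].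
have Dc1 : c = c0 + y3 * c' by [].
rewrite D Da1 Db1 Dc1 De.
rewrite (eq_of_sub Dk (_ : a0 - (e * x23 + y1 * k) = _)); last by ring.
rewrite (eq_of_sub Db (_ : b0 - (y2 * k - e * x13) = _)); last by ring.
by rewrite /g13 /g23 /g33; ring.
Qed.

Lemma g44_nzd_mod_minors p :
  g44 * p \in ideal3 g13 g23 g33 -> p \in ideal3 g13 g23 g33.
Proof.
apply: (@nzd_mod_linear K 10 o34 3 _ (- y3) (- x14 * y1 - x24 * y2)).
- free_row.
- free.
- free.
- by fold_vars; rewrite /g44; ring.
move=> q; rewrite mulNr => /ideal3P[a [b [c Dab]]]; apply: y3_nzd_mod_minors.
by apply/ideal3P; exists (- a), (- b), (- c); lc (congr1 -%R Dab).
Qed.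

(** * Syzygies at each stage of the resolution *)

Lemma g14_neq0 : g14 != 0.
Proof. by apply: contraNneq g13_neq0 => E; rewrite -kill4_g14 E rmorph0. Qed.

Lemma g24_neq0 : g24 != 0.
Proof. by apply: contraNneq g23_neq0 => E; rewrite -kill4_g24 E rmorph0. Qed.

Lemma g34_neq0 : g34 != 0.
Proof.
suff: kill o4 g34 != 0 by apply: contraNneq => ->; rewrite rmorph0.
suff -> : kill o4 g34 = g33 by apply: g33_neq0.
by kills.
Qed.

(** At [y4 = 0], regularity of [g44] puts [v4] in [(g13, g23, g33, y4)], the ideal of the last
    entries of columns 1 to 4 of [d24]. Removing these columns leaves a syzygy of the regular
    sequence [g14], [g24], [g34], hence a combination of the Koszul columns 5 to 7. *)
Lemma syzygies1 (v1 v2 v3 v4 : R) :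
  g14 * v1 + g24 * v2 + g34 * v3 + g44 * v4 = 0 ->
  exists c1 c2 c3 c4 c5 c6 c7,
  [/\ v1 = (g44 + x14 * y1) * c1 + x24 * y1 * c2 + x34 * y1 * c3 - y1 * c4
           + g24 * c5 - g34 * c7,
      v2 = x14 * y2 * c1 + (g44 + x24 * y2) * c2 + x34 * y2 * c3 - y2 * c4
           - g14 * c5 + g34 * c6,
      v3 = x14 * y3 * c1 + x24 * y3 * c2 + (g44 + x34 * y3) * c3 - y3 * c4
           - g24 * c6 + g14 * c7
    & v4 = - g13 * c1 - g23 * c2 - g33 * c3 - y4 * c4].
Proof.
move=> E.
have /ideal3P[a [b [c D4]]] : kill o4 v4 \in ideal3 g13 g23 g33.
  apply: g44_nzd_mod_minors; have := congr1 (kill o4) E.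
  rewrite rmorph0 !rmorphD !rmorphM kill4_g14 kill4_g24.
  have -> : kill o4 g34 = g33 by kills.
  have -> : kill o4 g44 = g44 by kills.
  move=> E0; apply/ideal3P.
  by exists (- kill o4 v1), (- kill o4 v2), (- kill o4 v3); lc E0.
have [d Dv4] := kill_decomp o4 v4.
have {}D4 : v4 = a * g13 + b * g23 + c * g33 + y4 * d by rewrite -D4.
move: {Dv4} D4 => D4.
(* The vector [v] with columns 1 to 4 of [d24] added, with coefficients [a], [b], [c], [d], so that
   the last coordinate cancels. *)
pose w1 := v1 + (g44 + x14 * y1) * a + x24 * y1 * b + x34 * y1 * c - y1 * d.
pose w2 := v2 + x14 * y2 * a + (g44 + x24 * y2) * b + x34 * y2 * c - y2 * d.
pose w3 := v3 + x14 * y3 * a + x24 * y3 * b + (g44 + x34 * y3) * c - y3 * d.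
have {}E : g14 * w1 + g24 * w2 + g34 * w3 = 0.
  by rewrite D4 in E; rewrite /w1 /w2 /w3; lc E.
have /ideal2P[p [q D3]] : w3 \in ideal2 g14 g24.
  by apply: g34_nzd_mod_g14_g24; apply/ideal2P; exists (- w1), (- w2); lc E.
have {}E : g14 * (w1 + g34 * p) + g24 * (w2 + g34 * q) = 0.
  by rewrite D3 in E; lc E.
have /ideal1P[r D2] : w2 + g34 * q \in ideal1 g14.
  by apply: g24_nzd_mod_g14; apply/ideal1P; exists (- (w1 + g34 * p)); lc E.
have D1 : w1 + g34 * p = - r * g24.
  by apply: (mulfI g14_neq0); rewrite D2 in E; lc E.
exists (- a), (- b), (- c), (- d), (- r), (- q), p; split.
- by rewrite /w1 in D1; lc D1.
- by rewrite /w2 in D2; lc D2.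
- by rewrite /w3 in D3; lc D3.
- by rewrite D4; ring.
Qed.

(** At [y4 = 0] the last equation is a syzygy of the minors, so Hilbert-Burch determines [v1], [v2],
    [v3] up to multiples of [y4]; cancelling [y4] gives [v4]. The remainder in coordinates 5 to 7 is
    a multiple of [(g34, g14, g24)]. *)
Lemma syzygies2 (v1 v2 v3 v4 v5 v6 v7 : R) :
    (g44 + x14 * y1) * v1 + x24 * y1 * v2 + x34 * y1 * v3 - y1 * v4
      + g24 * v5 - g34 * v7 = 0 ->
    x14 * y2 * v1 + (g44 + x24 * y2) * v2 + x34 * y2 * v3 - y2 * v4
      - g14 * v5 + g34 * v6 = 0 ->
    - g13 * v1 - g23 * v2 - g33 * v3 - y4 * v4 = 0 ->
  exists c1 c2 c3 c4 c5,
  [/\ v1 = - x23 * c1 - y1 * c2 + y4 * c3,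
      v2 = x13 * c1 - y2 * c2 + y4 * c4,
      v3 = - x12 * c1 - y3 * c2 + y4 * c5,
      v4 = - g13 * c3 - g23 * c4 - g33 * c5
    & [/\ v5 = - x34 * c1 + y2 * c3 - y1 * c4,
      v6 = - x14 * c1 + y3 * c4 - y2 * c5
    & v7 = - x24 * c1 - y3 * c3 + y1 * c5]].
Proof.
move=> E1 E2 E4.
have [a [b [D1 D2 D3]]] : exists a b, [/\ kill o4 v1 = a * x23 + b * y1,
  kill o4 v2 = - a * x13 + b * y2 & kill o4 v3 = a * x12 + b * y3].
  have {}E4 : g13 * v1 + g23 * v2 + g33 * v3 + y4 * v4 = 0 by lc (esym E4).
  apply: hilbert_burch; have := congr1 (kill o4) E4.
  rewrite rmorph0 !rmorphD !rmorphM (killX K o4 o4) eqxx kill4_g33.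
  have -> : kill o4 g13 = g13 by kills.
  have -> : kill o4 g23 = g23 by kills.
  by move=> E0; lc E0.
have [w1 Dv1] := kill_decomp o4 v1; have [w2 Dv2] := kill_decomp o4 v2.
have [w3 Dv3] := kill_decomp o4 v3.
have {}D1 : v1 = a * x23 + b * y1 + y4 * w1 by rewrite -D1.
have {}D2 : v2 = - a * x13 + b * y2 + y4 * w2 by rewrite -D2.
have {}D3 : v3 = a * x12 + b * y3 + y4 * w3 by rewrite -D3.
move: {Dv1 Dv2 Dv3} D1 D2 D3 => D1 D2 D3.
have D4 : v4 = - g13 * w1 - g23 * w2 - g33 * w3.
  apply: (mulfI (mpolyX_neq0 K o4)); fold_vars.
  by rewrite D1 D2 D3 in E4; lc (esym E4).
(* Subtract the combination of columns of [d34] with coefficients [- a], [- b], [w1], [w2], [w3],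
   which already matches coordinates 1 to 4. *)
pose u5 := v5 - (x34 * a + y2 * w1 - y1 * w2).
pose u6 := v6 - (x14 * a + y3 * w2 - y2 * w3).
pose u7 := v7 - (x24 * a - y3 * w1 + y1 * w3).
have {}E1 : g34 * u7 = u5 * g24.
  by rewrite D1 D2 D3 D4 in E1; rewrite /u5 /u7; lc (esym E1).
have {}E2 : g34 * u6 = g14 * u5.
  by rewrite D1 D2 D3 D4 in E2; rewrite /u5 /u6; lc E2.
have /ideal1P[e D7] : u7 \in ideal1 g24.
  by apply: g34_nzd_mod_g24; apply/ideal1P; exists u5.
have D5 : u5 = e * g34.
  by apply: (mulfI g24_neq0); rewrite D7 in E1; lc (esym E1).
have D6 : u6 = e * g14.
  by apply: (mulfI g34_neq0); rewrite D5 in E2; lc E2.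
(* The combination of columns with coefficients [- y4, 0, - x23, x13, - x12] is
   [(0, 0, 0, 0, g34, g14, g24)]; [e] times it is added. *)
exists (- a - e * y4), (- b), (w1 - e * x23), (w2 + e * x13), (w3 - e * x12).
split; last split.
- by rewrite D1; ring.
- by rewrite D2; ring.
- by rewrite D3; ring.
- by rewrite D4 /g13 /g23 /g33; ring.
- by rewrite /u5 in D5; lc D5.
- by rewrite /u6 in D6; lc D6.
- by rewrite /u7 in D7; lc D7.
Qed.

(** Primality of [y4] gives [v1 = y4 * w] and [v2 = y4 * c]; the first three equations then yield
    the other coordinates, and the fourth becomes [g34 * w = 0]. *)
Lemma syzygies3 (v1 v2 v3 v4 v5 : R) :
    - x23 * v1 - y1 * v2 + y4 * v3 = 0 ->
    x13 * v1 - y2 * v2 + y4 * v4 = 0 ->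
    - x12 * v1 - y3 * v2 + y4 * v5 = 0 ->
    - x34 * v1 + y2 * v3 - y1 * v4 = 0 ->
  exists c, [/\ v1 = 0, v2 = y4 * c, v3 = y1 * c, v4 = y2 * c & v5 = y3 * c].
Proof.
move=> E1 E2 E3 E5.
have [w D1] : exists w, v1 = y4 * w.
  apply: (@variable_prime K 10 o4 g33 v1 (y1 * v4 - y2 * v3)).
    by rewrite kill4_g33 g33_neq0.
  (* Eliminating [v2] between the first two equations leaves [g33 * v1] plus a multiple of [y4]. *)
  by fold_vars; lc (lin_comb2 y2 (- y1) E1 E2).
have [c D2] : exists c, v2 = y4 * c.
  apply: (@variable_prime K 10 o4 y1 v2 (v3 - x23 * w)).
    suff -> : kill o4 y1 = y1 by apply: mpolyX_neq0.
    by kills.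
  by fold_vars; rewrite D1 in E1; lc (esym E1).
have y4K := mulfI (mpolyX_neq0 K o4).
have D3 : v3 = x23 * w + y1 * c.
  by apply: y4K; fold_vars; rewrite D1 D2 in E1; lc E1.
have D4 : v4 = - x13 * w + y2 * c.
  by apply: y4K; fold_vars; rewrite D1 D2 in E2; lc E2.
have D5 : v5 = x12 * w + y3 * c.
  by apply: y4K; fold_vars; rewrite D1 D2 in E3; lc E3.
have w0 : w = 0.
  apply: (mulfI g34_neq0).
  by rewrite D1 D3 D4 in E5; lc (esym E5).
by exists c; rewrite D1 D2 D3 D4 D5 w0 !mulr0 !add0r.
Qed.

(** * Composites vanish, and exactness *)

Lemma d14_d24 : d14 K *m d24 K = 0.
Proof.
apply: mul_rows_eq0 => i k lt_i lt_k.
rewrite 4?big_nat_recl // big_geq //= addr0.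
case: i lt_i => [|//] _ /=.
by case: k lt_k => [|[|[|[|[|[|[|//]]]]]]] _ /=;
  rewrite /g14 /g24 /g34 /g44 /g13 /g23 /g33; ring.
Qed.

Lemma d24_d34 : d24 K *m d34 K = 0.
Proof.
apply: mul_rows_eq0 => i k lt_i lt_k.
rewrite 7?big_nat_recl // big_geq //= addr0.
by case: i lt_i => [|[|[|[|//]]]] _ /=; case: k lt_k => [|[|[|[|[|//]]]]] _ /=;
  rewrite /g14 /g24 /g34 /g44 /g13 /g23 /g33; ring.
Qed.

Lemma d34_d44 : d34 K *m d44 K = 0.
Proof.
apply: mul_rows_eq0 => i k lt_i lt_k.
rewrite 5?big_nat_recl // big_geq //= addr0.
by case: k lt_k => [|//] _; case: i lt_i => [|[|[|[|[|[|[|//]]]]]]] _ /=;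
  rewrite /g13 /g23 /g33; ring.
Qed.

Lemma exact_d14_d24 :
  exact_at (fun v : 'cV[R]_7 => d24 K *m v) (fun v : 'cV[R]_4 => d14 K *m v).
Proof.
apply: exact_at_mulmx d14_d24 _ => v; have [f ->] := col_of_nat_fun v.
move=> /mul_rows_col_eq0/(_ 0%N isT).
rewrite 4?big_nat_recl // big_geq //= addr0 !addrA => E.
have [c1 [c2 [c3 [c4 [c5 [c6 [c7 [E1 E2 E3 E4]]]]]]]] := syzygies1 E.
exists (\col_(i < 7) nth 0 [:: c1; c2; c3; c4; c5; c6; c7] i).
apply: col_eq_mul_rows => k lt_k.
rewrite 7?big_nat_recl // big_geq //= addr0.
by case: k lt_k => [|[|[|[|//]]]] _ /=; rewrite ?E1 ?E2 ?E3 ?E4; ring.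
Qed.

Lemma exact_d24_d34 :
  exact_at (fun v : 'cV[R]_5 => d34 K *m v) (fun v : 'cV[R]_7 => d24 K *m v).
Proof.
apply: exact_at_mulmx d24_d34 _ => v; have [f ->] := col_of_nat_fun v.
move=> /mul_rows_col_eq0 E.
have := E 0%N isT; have := E 1%N isT; have := E 3%N isT; clear E.
rewrite !big_nat_recl // !big_geq //= !addr0 !addrA => E4 E2 E1.
have [|||c1 [c2 [c3 [c4 [c5 [E1' E2' E3' E4' [E5' E6' E7']]]]]]] :=
  @syzygies2 (f 0%N) (f 1%N) (f 2%N) (f 3%N) (f 4%N) (f 5%N) (f 6%N).
- by lc E1.
- by lc E2.
- by lc E4.
exists (\col_(i < 5) nth 0 [:: c1; c2; c3; c4; c5] i).
apply: col_eq_mul_rows => k lt_k.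
rewrite 5?big_nat_recl // big_geq //= addr0.
by case: k lt_k => [|[|[|[|[|[|[|//]]]]]]] _ /=;
  rewrite ?E1' ?E2' ?E3' ?E4' ?E5' ?E6' ?E7'; ring.
Qed.

Lemma exact_d34_d44 :
  exact_at (fun v : 'cV[R]_1 => d44 K *m v) (fun v : 'cV[R]_5 => d34 K *m v).
Proof.
apply: exact_at_mulmx d34_d44 _ => v; have [f ->] := col_of_nat_fun v.
move=> /mul_rows_col_eq0 E.
have := E 0%N isT; have := E 1%N isT; have := E 2%N isT; have := E 4%N isT; clear E.
rewrite !big_nat_recl // !big_geq //= !addr0 !addrA => E5 E3 E2 E1.
have [||||c [E1' E2' E3' E4' E5']] :=
  @syzygies3 (f 0%N) (f 1%N) (f 2%N) (f 3%N) (f 4%N).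
- by lc E1.
- by lc E2.
- by lc E3.
- by lc E5.
exists (\col_(i < 1) nth 0 [:: c] i).
apply: col_eq_mul_rows => k lt_k.
rewrite big_nat1 /=.
by case: k lt_k => [|[|[|[|[|//]]]]] _ /=;
  rewrite ?E1' ?E2' ?E3' ?E4' ?E5'; ring.
Qed.

Lemma d44_inj (v : 'cV[R]_1) : d44 K *m v = 0 -> v = 0.
Proof.
have [f ->] := col_of_nat_fun v.
(* Row 1, counted from 0, holds the entry [y4]. *)
move=> /mul_rows_col_eq0/(_ 1%N isT); rewrite big_nat1 /= => E.
apply/matrixP => i j; rewrite !mxE ord1.
by apply: (mulfI (mpolyX_neq0 K o4)); rewrite mulr0.
Qed.

Lemma d04_linear : linear (d04 (K := K)).
Proof.
move=> a u v; rewrite /d04 !mxE raddfD; congr (_ + _).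
by rewrite [RHS]quot_scaleE.
Qed.

Lemma d04_surj (u : R_mod_L4 K) : exists v, u = d04 v.
Proof.
by have [p ->] := quot_proj_surj u; exists (\col__ p); rewrite /d04 mxE.
Qed.

Lemma exact_d04_d14 : exact_at (fun v : 'cV[R]_4 => d14 K *m v) (d04 (K := K)).
Proof.
have kerP (v : 'cV[R]_1) : d04 v = 0 <-> v 0 0 \in ideal_gen (gens4 K).
  rewrite -[v 0 0]subr0; split=> [v0|/quot_projP v0].
    by apply/quot_projP; rewrite raddf0.
  by rewrite /d04 v0 raddf0.
move=> v; rewrite kerP; split=> [/ideal_genP[c Dc]|[u ->]].
  exists c; apply/matrixP => i j; rewrite !ord1 mxE Dc.
  by apply: eq_bigr => k _; rewrite mulrC.
by apply/ideal_genP; exists u; rewrite mxE; apply: eq_bigr => k _; rewrite mulrC.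
Qed.

Lemma ranks4_empty i : 'I_(ranks4 i.+1.+4) -> False.
Proof. by rewrite /ranks4 nth_default // => -[]. Qed.

Lemma free_resolution4 : free_resolution (diff4 K) (d04 (K := K)).
Proof.
split; [exact: d04_linear | exact: d04_surj | exact: exact_d04_d14 |].
case=> [|[|[|[|i]]]].
- exact: exact_d14_d24.
- exact: exact_d24_d34.
- exact: exact_d34_d44.
(* The next differential starts from the zero module, so exactness here is injectivity of [d44]. *)
- move=> v; split=> [/d44_inj -> | [u ->]]; last by rewrite mul0mx mulmx0.
  by exists 0; rewrite mulmx0.
move=> v; split=> [_|_]; last by rewrite mul0mx.
by exists 0; apply/matrixP => j; case: (ranks4_empty j).
Qed.

(** * Grading and minimality *)

(** The shifts of the graded resolution; the single 3 belongs to the column of [d24] with linear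
    entries [- y1], ..., [- y4]. *)
Definition degrees4 (i : nat) (j : 'I_(ranks4 i)) : nat :=
  nth 0%N (nth [::] [:: [:: 0]; [:: 2; 2; 2; 2]; [:: 4; 4; 4; 3; 4; 4; 4];
                        [:: 5; 5; 5; 5; 5]; [:: 6]]%N i) j.

Ltac solve_homog := rewrite /g14 /g24 /g34 /g44 /g13 /g23 /g33;
  repeat first [exact: rpred0 | exact: variable_homog | apply: rpredD
    | rewrite rpredN | apply: (@dhomogM _ _ _ 1 _ 1)].

Lemma diff4_homog i j k : (degrees4 j <= degrees4 k)%N
  && (diff4 K i j k \is (degrees4 k - degrees4 j).-homog).
Proof.
case: i j k => [|[|[|[|i]]]] [j lt_j] [k lt_k]; last first.
- by case: (ranks4_empty (Ordinal lt_k)).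
- rewrite !mxE /degrees4 /=.
  by case: k lt_k => [|//] _; case: j lt_j => [|[|[|[|[|//]]]]] _ /=; solve_homog.
- rewrite !mxE /degrees4 /=.
  by case: j lt_j => [|[|[|[|[|[|[|//]]]]]]] _;
    case: k lt_k => [|[|[|[|[|//]]]]] _ /=; solve_homog.
- rewrite !mxE /degrees4 /=.
  by case: j lt_j => [|[|[|[|//]]]] _;
    case: k lt_k => [|[|[|[|[|[|[|//]]]]]]] _ /=; solve_homog.
rewrite !mxE /degrees4 /=.
by case: j lt_j => [|//] _; case: k lt_k => [|[|[|[|//]]]] _ /=; solve_homog.
Qed.

Lemma graded_complex4 :
  graded_complex (@quot_grading K 10 4 (gens4 K)) (diff4 K) (d04 (K := K)).
Proof.
exists degrees4; split=> [t v homv | i t v]; last first.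
  exact/homog_mulmx/diff4_homog.
by exists (v 0 0) => //; have := homv 0; rewrite /degrees4 /= subn0.
Qed.

Ltac in_max_ideal := rewrite /max_ideal /g14 /g24 /g34 /g44 /g13 /g23 /g33;
  repeat first [exact: rpred0 | exact: variable_max_ideal | apply: rpredD
    | rewrite rpredN | apply: ideal_genM].

Lemma diff4_minimal i j k : diff4 K i j k \in @max_ideal K 10.
Proof.
case: i j k => [|[|[|[|i]]]] [j lt_j] [k lt_k]; last first.
- by rewrite mxE; in_max_ideal.
- rewrite !mxE /=.
  by case: k lt_k => [|//] _; case: j lt_j => [|[|[|[|[|//]]]]] _ /=; in_max_ideal.
- rewrite !mxE /=.
  by case: j lt_j => [|[|[|[|[|[|[|//]]]]]]] _;
    case: k lt_k => [|[|[|[|[|//]]]]] _ /=; in_max_ideal.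
- rewrite !mxE /=.
  by case: j lt_j => [|[|[|[|//]]]] _;
    case: k lt_k => [|[|[|[|[|[|[|//]]]]]]] _ /=; in_max_ideal.
rewrite !mxE /=.
by case: j lt_j => [|//] _; case: k lt_k => [|[|[|[|//]]]] _ /=; in_max_ideal.
Qed.

End L4.

Theorem mainTheorem4 (K : fieldType) :
  @minimal_graded_free_resolution K 10 (R_mod_L4 K)
    (@quot_grading K 10 4 (gens4 K)) ranks4 (diff4 K) (d04 (K := K)).
Proof.
by split; [exact: free_resolution4 | exact: graded_complex4 | exact: diff4_minimal].
Qed.
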